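(* Let $\alpha\in[1,2)$, $q>\alpha+\frac12$ and $s>\frac1\alpha$. Then for every $\tau>0$ the problem $$\partial_t\theta+u\cdot\nabla\theta=0,\qquad u=(-\Delta)^{\alpha/2}\mathbf{I}\theta,\qquad \theta(\mathbf{x},0)=\theta_0(\mathbf{x})$$ on $\mathbb{T}^2\times(0,\infty)$ is locally Lipschitz $(H^q,G^s_\tau)$ ill-posed, i.e. not locally Lipschitz $(H^q,G^s_\tau)$ well-posed.
   Context: $\mathbb{T}^2=[0,2\pi]^2$ periodic; functions mean-free. $\mathbf{I}=(\mathbf{I}_1,\mathbf{I}_2)$ is the Fourier multiplier with symbols $\widehat{\mathbf{I}}_1(\mathbf{k})=\frac{-k_1k_2}{k_1^2+k_2^2}$, $\widehat{\mathbf{I}}_2(\mathbf{k})=\frac{k_1^2}{k_1^2+k_2^2}$ for $\mathbf{k}\ne0$, $\widehat{\mathbf{I}}(0,0)=0$; $(-\Delta)^{\alpha/2}$ has symbol $|\mathbf{k}|^\alpha$, so $(-\Delta)^{\alpha/2}\mathbf{I}$ is singular of order $r_0=\alpha$. For fixed $r>3$: $\|\theta\|_{G^s_\tau}^2=\sum_{\mathbf{k}\ne0}|\mathbf{k}|^{2r}e^{2\tau|\mathbf{k}|^{1/s}}|\widehat\theta(\mathbf{k})|^2$. Definition: for Banach spaces $Y\subset X\subset H^q$ (with $q>r_0+\frac d4$, here $d=2$), the problem is locally Lipschitz $(X,Y)$ well-posed if there exist continuous $T,K:[0,\infty)^2\to(0,\infty)$ such that for all initial data $\theta_0^{(1)},\theta_0^{(2)}\in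 Y$ there are unique solutions $\theta^{(1)},\theta^{(2)}\in L^\infty(0,T;X)$ with $\|\theta^{(1)}(t)-\theta^{(2)}(t)\|_X\le K\|\theta_0^{(1)}-\theta_0^{(2)}\|_Y$ for all $t\in[0,T]$, where $T,K$ are evaluated at $(\|\theta_0^{(1)}\|_Y,\|\theta_0^{(2)}\|_Y)$. *)

(* Defs.v *)
From HB Require Import structures.
From mathcomp Require Import all_boot all_order all_algebra.
From mathcomp Require Import all_classical all_reals all_analysis.
Set Implicit Arguments. Unset Strict Implicit. Unset Printing Implicit Defensive.
Import Order.TTheory GRing.Theory Num.Theory.
Import numFieldNormedType.Exports.
Local Open Scope classical_set_scope.
Local Open Scope ring_scope.

(* Functions on T^2 = [0,2pi]^2 are represented by their Fourier coefficients
   f(x) = sum_{k in Z^2} fhat(k) e^{i k.x};  a coefficient is a complex number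
   written as the pair (real part, imaginary part). *)
Definition Z2 := (int * int)%type.
Definition coef (R : realType) := Z2 -> (R * R)%type.

Section Defs.
Variable R : realType.

Definition Zsub (k j : Z2) : Z2 := (k.1 - j.1, k.2 - j.2)%R.
Definition Zopp (k : Z2) : Z2 := (- k.1, - k.2)%R.

Definition ksq (k : Z2) : R := (k.1%:~R) ^+ 2 + (k.2%:~R) ^+ 2.

(* symbols of the Fourier multiplier I = (I_1, I_2), zero at k = 0 *)
Definition I1 (k : Z2) : R :=
  if k == (0, 0)%R then 0 else - (k.1%:~R * k.2%:~R) / ksq k.
Definition I2 (k : Z2) : R :=
  if k == (0, 0)%R then 0 else (k.1%:~R) ^+ 2 / ksq k.

(* k . \hat{(-Delta)^{alpha/2} I}(j) = |j|^alpha (k_1 I_1(j) + k_2 I_2(j)) *)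
Definition mult (alpha : R) (k j : Z2) : R :=
  (ksq j) `^ (alpha / 2) * (k.1%:~R * I1 j + k.2%:~R * I2 j).

Definition cmul (x y : R * R) : R * R :=
  (x.1 * y.1 - x.2 * y.2, x.1 * y.2 + x.2 * y.1).

Definition zbox (n : nat) : seq int := [seq (i%:Z - n%:Z)%R | i <- iota 0 (2 * n).+1].
Definition boxsum (n : nat) (F : Z2 -> R) : R :=
  \sum_(j1 <- zbox n) \sum_(j2 <- zbox n) F (j1, j2).
Definition zseries (F : Z2 -> R) : R := limn (fun n => boxsum n F).

(* Fourier coefficient k of - (u . grad theta) = - div (u theta),
   u = (-Delta)^{alpha/2} I theta:
   -i sum_j (k . u_hat(j)) theta_hat(k-j) *)
Definition conv (alpha : R) (th : coef R) (k : Z2) : R * R :=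
  (zseries (fun j => mult alpha k j * (cmul (th j) (th (Zsub k j))).1),
   zseries (fun j => mult alpha k j * (cmul (th j) (th (Zsub k j))).2)).
Definition rhs (alpha : R) (th : coef R) (k : Z2) : R * R :=
  ((conv alpha th k).2, - (conv alpha th k).1).

Definition csub (f g : coef R) : coef R := fun k => ((f k).1 - (g k).1, (f k).2 - (g k).2).

Definition realvalued (f : coef R) : Prop :=
  forall k, (f (Zopp k)).1 = (f k).1 /\ (f (Zopp k)).2 = - (f k).2.
Definition meanfree (f : coef R) : Prop := f (0, 0)%R = (0, 0).

Definition cabs2 (x : R * R) : R := x.1 ^+ 2 + x.2 ^+ 2.

Definition Hnorm2 (q : R) (f : coef R) : \bar R :=
  (\esum_(k in [set k : Z2 | k != (0, 0)%R]) ((ksq k) `^ q * cabs2 (f k))%:E)%E.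
Definition Hnorm (q : R) (f : coef R) : R := Num.sqrt (fine (Hnorm2 q f)).

Definition Gnorm2 (r s tau : R) (f : coef R) : \bar R :=
  (\esum_(k in [set k : Z2 | k != (0, 0)%R])
     ((ksq k) `^ r * expR (2 * tau * (ksq k) `^ (1 / (2 * s))) * cabs2 (f k))%:E)%E.
Definition Gnorm (r s tau : R) (f : coef R) : R := Num.sqrt (fine (Gnorm2 r s tau f)).

Definition inH (q : R) (f : coef R) : Prop :=
  realvalued f /\ meanfree f /\ (Hnorm2 q f < +oo)%E.
Definition inG (r s tau : R) (f : coef R) : Prop :=
  realvalued f /\ meanfree f /\ (Gnorm2 r s tau f < +oo)%E.

(* theta in L^infty(0,T;H^q) is a (weak) solution with data th0:
   each Fourier coefficient is measurable in time and satisfies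
   thhat(k,t) = th0hat(k) + int_0^t (-(u.grad theta))^(k)(s) ds
   (the weak formulation tested against e^{-ik.x}). *)
Definition is_solution (alpha q T : R) (th0 : coef R) (th : R -> coef R) : Prop :=
  [/\ forall t, 0 <= t <= T -> inH q (th t),
      exists M : R, forall t, 0 <= t <= T -> Hnorm q (th t) <= M,
      forall k, measurable_fun `[0, T] (fun t => (th t k).1) /\
                measurable_fun `[0, T] (fun t => (th t k).2) &
      forall t, 0 <= t <= T -> forall k,
        (th t k).1 = (th0 k).1 +
            Rintegral (@lebesgue_measure R) `[0, t] (fun u => (rhs alpha (th u) k).1) /\
        (th t k).2 = (th0 k).2 +
            Rintegral (@lebesgue_measure R) `[0, t] (fun u => (rhs alpha (th u) k).2)].

Definition unique_solution (alpha q T : R) (th0 : coef R) (th : R -> coef R) : Prop :=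
  is_solution alpha q T th0 th /\
  forall th', is_solution alpha q T th0 th' -> forall t, 0 <= t <= T -> th' t = th t.

Definition nonneg2 : set (R * R) := [set p | 0 <= p.1 /\ 0 <= p.2].

Definition LLWP (alpha q r s tau : R) : Prop :=
  exists Tf Kf : R * R -> R,
    [/\ {within nonneg2, continuous Tf}, {within nonneg2, continuous Kf},
        (forall p, nonneg2 p -> 0 < Tf p /\ 0 < Kf p) &
        forall th01 th02 : coef R, inG r s tau th01 -> inG r s tau th02 ->
          let p := (Gnorm r s tau th01, Gnorm r s tau th02) in
          exists th1 th2 : R -> coef R,
            [/\ unique_solution alpha q (Tf p) th01 th1,
                unique_solution alpha q (Tf p) th02 th2 &
                forall t, 0 <= t <= Tf p ->
                  Hnorm q (csub (th1 t) (th2 t)) <= Kf p * Gnorm r s tau (csub th01 th02)]].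

End Defs.

(* Main.v *)
(* The shear profile -2 sin(x_2) is steady, since its velocity vanishes.  Perturbing
   it by 2 eps cos(N x_1), the modes (N, n), n in Z, satisfy up to an O(eps^2) error the
   linear system x_n' = m_(n-1) x_(n-1) + m_(n+1) x_(n+1) with nonnegative coefficients
   m_n, where m_0 and m_1 are at least N^alpha / 2.  Well-posedness bounds every x_n by
   A eps, and Picard iteration started from the crude bound x_n >= - A eps shows, as
   eps -> 0, that the partial sums of exp(t N^alpha / 2) are at most 2 A.  As A is the
   Gevrey size N^r exp(tau N^(1/s)) of the mode up to a constant independent of N, and
   1/s < alpha, this fails for N large. *)
Require Import Defs.
From HB Require Import structures.
From mathcomp Require Import all_boot all_order all_algebra.
From mathcomp Require Import all_classical all_reals all_analysis.
From mathcomp Require Import measurable_realfun.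
From mathcomp Require Import ring lra zify.
Import Order.TTheory GRing.Theory Num.Theory.
Import numFieldNormedType.Exports.
Local Open Scope ring_scope.

(** * Lower bounds by Picard iteration *)

Lemma integrable_horner (R : realType) (p : {poly R}) (a b : R) :
  (@lebesgue_measure R).-integrable `[a, b]%classic (EFin \o horner p).
Proof.
apply: continuous_compact_integrable; first exact: segment_compact.
by apply: continuous_subspaceT => x; exact: continuous_horner.
Qed.

Lemma Rintegral_deriv_horner (R : realType) (p : {poly R}) (t : R) : 0 <= t ->
  Rintegral (@lebesgue_measure R) `[0, t]%classic (horner p^`()) = p.[t] - p.[0].
Proof.
rewrite le_eqVlt => /predU1P[<-|t0].
  by rewrite set_itv1 Rintegral_set1 subrr.
rewrite /Rintegral (@continuous_FTC2 _ _ (horner p))//.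
- by apply: continuous_subspaceT => x; exact: continuous_horner.
- split.
  + by move=> x _; exact: derivable_horner.
  + exact/cvg_at_right_filter/continuous_horner.
  + exact/cvg_at_left_filter/continuous_horner.
- by move=> x _; rewrite derivE.
Qed.

(** Integrates a differential inequality against a polynomial; the bound [M] turns the measurability
    of [f] into integrability. *)
Lemma Rintegral_horner_deriv_le (R : realType) (p : {poly R}) (f : R -> R) (M t : R) :
  0 <= t -> measurable_fun `[0, t]%classic f ->
  (forall u, 0 <= u <= t -> `|f u| <= M) ->
  (forall u, 0 <= u <= t -> p^`().[u] <= f u) ->
  p.[t] - p.[0] <= Rintegral (@lebesgue_measure R) `[0, t]%classic f.
Proof.
move=> t0 mf fM pf; rewrite -Rintegral_deriv_horner//.
apply: le_Rintegral => //.
- exact: integrable_horner.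
- apply: measurable_bounded_integrable => //.
    exact/compact_finite_measure/segment_compact.
  exists M; split; first exact: num_real.
  move=> N MN u /=; rewrite in_itv/= => /fM fuM.
  by rewrite (le_trans fuM)// ltW.
Qed.

(* The j-th derivative at 0 of the n-th component of the solution of
   x_n' = m_(n-1) x_(n-1) + m_(n+1) x_(n+1), x_n(0) = (n == 0). *)
Fixpoint taylor_coef (R : realType) (m : int -> R) (j : nat) (n : int) : R :=
  if j is j'.+1 then
    m (n - 1) * taylor_coef R m j' (n - 1) + m (n + 1) * taylor_coef R m j' (n + 1)
  else (n == 0)%:R.

(* The J-th Picard iterate started from the constant - a, with the negative part
   estimated through m_(n-1) + m_(n+1) <= b. *)
Definition picard_poly (R : realType) (m : int -> R) (a b : R) (J : nat) (n : int) : {poly R} :=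
  \sum_(j < J) (taylor_coef R m j n / (j`!)%:R) *: 'X^j - (a * b ^+ J / (J`!)%:R) *: 'X^J.

Lemma deriv_expdiv (R : realType) (a : R) (J : nat) :
  deriv ((a / (J.+1`!)%:R) *: 'X^(J.+1) : {poly R}) = (a / (J`!)%:R) *: 'X^J.
Proof.
rewrite derivZ derivXn /= -[X in _ *: X]scaler_nat scalerA; congr (_ *: _).
rewrite factS natrM.
have h : (J.+1%:R : R) != 0 by rewrite pnatr_eq0.
have h2 : (J`!%:R : R) != 0 by rewrite pnatr_eq0 -lt0n fact_gt0.
move: h h2; move: (_`!%:R) (J.+1%:R) => u v h h2; rewrite invfM.
by field; rewrite h h2.
Qed.

(** Differentiating shifts [taylor_coef], so the Taylor parts of both sides agree exactly. The
    negative remainders differ only by a factor, [b] on the left against [m (n - 1) + m (n + 1)] on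
    the right. *)
Lemma picard_poly_deriv (R : realType) (m : int -> R) (a b : R) (J : nat) (n : int) (t : R) :
  0 <= a -> 0 <= b -> 0 <= t -> m (n - 1) + m (n + 1) <= b ->
  (deriv (picard_poly R m a b J.+1 n)).[t] <=
  m (n - 1) * (picard_poly R m a b J (n - 1)).[t] +
  m (n + 1) * (picard_poly R m a b J (n + 1)).[t].
Proof.
move=> a0 b0 t0 mb; rewrite /picard_poly big_ord_recl/= expr0 alg_polyC.
rewrite derivB derivD derivC add0r deriv_expdiv raddf_sum/=.
rewrite (eq_bigr (fun j : 'I_J =>
   (taylor_coef R m j.+1 n / (j`!)%:R) *: 'X^j)); last first.
  by move=> j _; rewrite /bump/= add1n deriv_expdiv.
rewrite !hornerD !hornerN !horner_sum !mulrBr addrACA -opprD; apply: lerB.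
  rewrite !mulr_sumr -big_split/= le_eqVlt; apply/orP; left; apply/eqP.
  by apply: eq_bigr => j _; rewrite !hornerZ; ring.
rewrite !hornerZ hornerXn -mulrDl exprS.
rewrite [leRHS](_ : _ = b * (a * b ^+ J / (J`!)%:R * t ^+ J)); last by ring.
apply: ler_wpM2r => //.
by rewrite !mulr_ge0 ?exprn_ge0 ?invr_ge0.
Qed.

Lemma picard_poly0 (R : realType) (m : int -> R) (a b : R) (J : nat) (n : int) :
  (picard_poly R m a b J.+1 n).[0] = (n == 0)%:R.
Proof.
rewrite /picard_poly big_ord_recl/= expr0 alg_polyC fact0 divr1.
rewrite !hornerD hornerN horner_sum hornerZ hornerXn expr0n mulr0 subr0 hornerC.
by rewrite big1 ?addr0// => j _; rewrite hornerZ hornerXn expr0n mulr0.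
Qed.

(** Coefficient of [e ^+ 2] in the error after [J] Picard steps: each integration, over a time at
    most [T], adds the defect [C n] and the errors inherited from the two neighbours. *)
Fixpoint picard_error (R : realType) (m : int -> R) (T : R) (C : int -> R) (J : nat) (n : int) : R :=
  if J is J'.+1 then
    T * (C n + m (n - 1) * picard_error R m T C J' (n - 1) + m (n + 1) * picard_error R m T C J' (n + 1))
  else 0.

Lemma picard_error_ge0 (R : realType) (m : int -> R) (T : R) (C : int -> R) (J : nat) (n : int) :
  0 <= T -> (forall n, 0 <= C n) -> (forall n, 0 <= m n) -> 0 <= picard_error R m T C J n.
Proof.
by move=> T0 C0 m0; elim: J n => //= J ih n; rewrite mulr_ge0// !addr_ge0// mulr_ge0.
Qed.

(** Induction on [J], starting from the crude bound [- a * e]. As [m] is nonnegative, lower bounds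
    on the neighbours bound [f n] from below, and integration in time improves the bound on
    [x n]. *)
Lemma picard_lower_bound (R : realType) (m C : int -> R) (a b T e : R)
    (x f : int -> R -> R) :
  0 <= e -> 0 <= T ->
  (forall n, 0 <= m n) -> (forall n, m (n - 1) + m (n + 1) <= b) -> (forall n, 0 <= C n) ->
  (forall n t, 0 <= t <= T -> `|x n t| <= a * e) ->
  (forall n, measurable_fun `[0, T]%classic (f n)) ->
  (forall n t, 0 <= t <= T ->
     `|f n t - (m (n - 1) * x (n - 1) t + m (n + 1) * x (n + 1) t)| <= C n * e ^+ 2) ->
  (forall n t, 0 <= t <= T ->
     x n t = e * (n == 0)%:R + Rintegral (@lebesgue_measure R) `[0, t]%classic (f n)) ->
  0 <= a ->
  forall J n t, 0 <= t <= T ->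
    e * (picard_poly R m a b J n).[t] - picard_error R m T C J n * e ^+ 2 <= x n t.
Proof.
move=> e0 T0 m0 mb C0 xa mf fx xf a0.
have b0 : 0 <= b by apply: le_trans (mb 0); rewrite addr_ge0.
elim=> [n t tT|J ih n t /andP[t0 tT]].
  rewrite /= mul0r subr0 /picard_poly big_ord0 sub0r hornerN hornerZ hornerXn !expr0 mulr1.
  rewrite fact0 divr1 mulr1 mulrN lerNl mulrC (le_trans _ (xa n t tT))//.
  by rewrite -normrN ler_norm.
have sub u : 0 <= u <= t -> 0 <= u <= T by move=> /andP[-> /le_trans->].
have fle u : 0 <= u <= t -> `|f n u| <= b * (a * e) + C n * e ^+ 2.
  move=> /sub uT; rewrite -[f n u](subrK (m (n - 1) * x (n - 1) u + m (n + 1) * x (n + 1) u)).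
  rewrite (le_trans (ler_normD _ _))// addrC lerD ?fx//.
  rewrite (le_trans (ler_normD _ _))// !normrM !(ger0_norm (m0 _)).
  apply: (@le_trans _ _ ((m (n - 1) + m (n + 1)) * (a * e))).
    by rewrite mulrDl lerD// ler_wpM2l// xa.
  by rewrite ler_wpM2r// mulr_ge0.
set D := C n + m (n - 1) * picard_error R m T C J (n - 1) + m (n + 1) * picard_error R m T C J (n + 1).
have D0 : 0 <= D.
  by rewrite /D !addr_ge0// mulr_ge0// picard_error_ge0.
have hE (p : {poly R}) k u : (e *: p - k *: 'X).[u] = e * p.[u] - k * u.
  by rewrite hornerD hornerN !hornerZ hornerX.
(* The linear term of slope [D * e ^+ 2] absorbs both the defect of [f n] and the errors of the
   neighbours; at the end [t] is replaced by [T] in it. *)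
have := @Rintegral_horner_deriv_le R (e *: picard_poly R m a b J.+1 n - (D * e ^+ 2) *: 'X)
  (f n) _ t t0 _ fle.
rewrite xf ?t0// derivB !derivZ derivX !hE picard_poly0 mulr0 subr0 => H.
have {}H : e * (picard_poly R m a b J.+1 n).[t] - D * e ^+ 2 * t - e * (n == 0)%:R <=
    Rintegral (@lebesgue_measure R) `[0, t]%classic (f n).
  apply: H.
    apply: measurable_funS (mf n) => //.
  move=> u ut; have uT := sub _ ut.
  rewrite hornerD hornerN !hornerZ hornerC mulr1.
  have := fx n u uT; rewrite ler_distl => /andP[H1 _]; apply: le_trans H1.
  have h1 : 0 <= u by case/andP: uT.
  have h2 := ler_wpM2l e0 (picard_poly_deriv R m a b J n u a0 b0 h1 (mb n)).
  rewrite lerBlDr (le_trans h2)//.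
  have h3 := ler_wpM2l (m0 (n - 1)) (ih (n - 1) u uT).
  have h4 := ler_wpM2l (m0 (n + 1)) (ih (n + 1) u uT).
  rewrite /D; lra.
have h5 : D * e ^+ 2 * t <= D * e ^+ 2 * T.
  by rewrite ler_wpM2l// mulr_ge0// exprn_ge0.
rewrite [picard_error _ _ _ _ _ _]/= -/D; lra.
Qed.

(** * Exponential growth of the comparison system *)

Lemma taylor_coef_ge0 (R : realType) (m : int -> R) (j : nat) (n : int) :
  (forall n, 0 <= m n) -> 0 <= taylor_coef R m j n.
Proof.
by move=> m0; elim: j n => [|j ih] n /=; [case: eqP|rewrite addr_ge0// mulr_ge0].
Qed.

(** Components 0 and 1 feed each other: the next coefficient at 1 contains [m 0] times the one at 0,
    and conversely with [m 1]. The contributions from -1 and 2 are nonnegative and dropped. *)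
Lemma taylor_coef_growth (R : realType) (m : int -> R) (c : R) (j : nat) :
  (forall n, 0 <= m n) -> 0 <= c -> c <= m 0 -> c <= m 1 ->
  c ^+ j <= taylor_coef R m j 0 + taylor_coef R m j 1.
Proof.
move=> m0 c0 cm0 cm1; elim: j => [|j ih]; first by rewrite expr0 /= addr0.
rewrite exprS (le_trans (ler_wpM2l c0 ih))//= mulrDr subrr add0r.
have h n : 0 <= taylor_coef R m j n by exact: taylor_coef_ge0.
have h0 := ler_wpM2r (h 0) cm0; have h1 := ler_wpM2r (h 1) cm1.
have h2 := mulr_ge0 (m0 (0 - 1)) (h (0 - 1)).
have h3 := mulr_ge0 (m0 (1 + 1)) (h (1 + 1)).
lra.
Qed.

(** Two limits in this order: for fixed [J], letting [e] tend to 0 removes [picard_error], which may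
    grow with [J]; then letting [J] tend to infinity removes the remainder of [picard_poly]. *)
Lemma exp_growth_bound (R : realType) (m C : int -> R) (a b c T e0 : R) :
  0 < e0 -> 0 <= T ->
  (forall n, 0 <= m n) -> (forall n, m (n - 1) + m (n + 1) <= b) -> (forall n, 0 <= C n) ->
  0 <= c -> c <= m 0 -> c <= m 1 -> 0 <= a ->
  (forall e, 0 < e < e0 -> exists x f : int -> R -> R, [/\ (forall n t, 0 <= t <= T -> `|x n t| <= a * e),
    (forall n, measurable_fun `[0, T]%classic (f n)),
    (forall n t, 0 <= t <= T ->
     `|f n t - (m (n - 1) * x (n - 1) t + m (n + 1) * x (n + 1) t)| <= C n * e ^+ 2) &
    (forall n t, 0 <= t <= T ->
     x n t = e * (n == 0)%:R + Rintegral (@lebesgue_measure R) `[0, t]%classic (f n))]) ->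
  expR (c * T) <= 2 * a.
Proof.
move=> e0p T0 m0 mb C0 c0 cm0 cm1 a0 H.
have TT : 0 <= T <= T by rewrite T0 lexx.
have key J : (picard_poly R m a b J 0).[T] + (picard_poly R m a b J 1).[T] <= 2 * a.
  set D := picard_error R m T C J 0 + picard_error R m T C J 1.
  have D0 : 0 <= D by rewrite addr_ge0// picard_error_ge0.
  apply/ler_addgt0Pr => d d0.
  (* Small enough for admissibility and for [D * e <= d]; the denominator [D + 1] avoids division by
     zero. *)
  pose e := Num.min (e0 / 2) (d / (D + 1)).
  have ep : 0 < e by rewrite lt_min !divr_gt0// ltr_wpDl.
  have ee : e < e0 by rewrite gt_min ltr_pdivrMr// ltr_pMr// ltr1n.
  have ed : D * e <= d.
    have : e <= d / (D + 1) by rewrite ge_min lexx orbT.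
    by rewrite ler_pdivlMr ?ltr_wpDl// mulrDr mulr1 mulrC; lra.
  have [|x [f [h1 h2 h3 h4]]] := H e; first by rewrite ep.
  have L n := picard_lower_bound R m C a b T e x f (ltW ep) T0 m0 mb C0 h1 h2 h3 h4 a0 J n T TT.
  have U n := le_trans (L n) (le_trans (ler_norm _) (h1 n T TT)).
  have {}U n : (picard_poly R m a b J n).[T] <= a + picard_error R m T C J n * e.
    by rewrite -(ler_pM2l ep) mulrDr; have := U n; lra.
  have := U 0; have := U 1; rewrite /D in ed; lra.
(* Each of the two components carries the remainder [a * (b * T) ^+ J / J!], whence the factor 2. *)
have key2 J : series (exp_coeff (c * T)) J - 2 * a * exp_coeff (b * T) J <= 2 * a.
  apply: le_trans (key J); rewrite /picard_poly !hornerD !hornerN !horner_sum addrACA.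
  apply: lerD.
    rewrite -big_split/= seriesEnat/= big_mkord; apply: ler_sum => j _.
    rewrite !hornerZ hornerXn -mulrDl -mulrDl /exp_coeff/= exprMn mulrAC.
    rewrite ler_wpM2r ?exprn_ge0// ler_wpM2r ?invr_ge0//.
    exact: taylor_coef_growth.
  rewrite le_eqVlt; apply/orP; left; apply/eqP.
  by rewrite !hornerZ hornerXn /exp_coeff/= exprMn; ring.
have cv1 := is_cvg_series_exp_coeff (c * T).
have cv2 := cvg_exp_coeff (b * T).
have cv3 : (series (exp_coeff (c * T)) J - 2 * a * exp_coeff (b * T) J @[J --> \oo] -->
     expR (c * T) - 2 * a * 0)%classic.
  by apply: cvgB => //; apply: cvgM => //; exact: cvg_cst.
rewrite mulr0 subr0 in cv3.
by apply: (cvgr_to_le cv3); exact: nearW.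
Qed.

(** * Fourier sums and the quadratic term *)

Lemma zbox_uniq n : uniq (zbox n).
Proof.
by rewrite map_inj_uniq ?iota_uniq// => i j /eqP; rewrite (inj_eq (addIr _)) eqz_nat => /eqP.
Qed.

Lemma mem_zbox n (i : int) : (i \in zbox n) = (`|i| <= n)%N.
Proof.
apply/mapP/idP => [[k]|hi].
  rewrite mem_iota => hk ->; lia.
by exists (absz (i + n%:Z)); [rewrite mem_iota; lia|lia].
Qed.

Definition box (n : nat) : seq Z2 := [seq (i, j) | i <- zbox n, j <- zbox n].

Lemma box_uniq n : uniq (box n).
Proof. by apply: allpairs_uniq; rewrite ?zbox_uniq// => -[? ?] [? ?]. Qed.

Lemma mem_box n (p : Z2) : (p \in box n) = (`|p.1| <= n)%N && (`|p.2| <= n)%N.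
Proof.
case: p => i j; rewrite -!mem_zbox.
apply/allpairsP/andP => [[[a b] /= [? ? [-> ->]]]//|[? ?]].
by exists (i, j).
Qed.

Lemma boxsumE (R : realType) n (F : Z2 -> R) : boxsum n F = \sum_(p <- box n) F p.
Proof. by rewrite /boxsum big_allpairs. Qed.

Lemma ler_sum_uniq_subset (R : numDomainType) (T : eqType) (s t : seq T) (F : T -> R) :
  uniq s -> uniq t -> {subset s <= t} -> (forall i, 0 <= F i) ->
  \sum_(i <- s) F i <= \sum_(i <- t) F i.
Proof.
move=> us ut st F0; rewrite [leRHS](bigID [in s])/= -[X in X + _]big_filter.
have -> : \sum_(i <- s) F i = \sum_(i <- [seq i <- t | i \in s]) F i.
  apply/perm_big/uniq_perm => //; first exact: filter_uniq.
  by move=> i; rewrite mem_filter; case: (boolP (i \in s)) => // /st.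
by rewrite lerDl sumr_ge0.
Qed.

(** Writes [F] as [(|F| + F) - |F|]; both parts are nonnegative, so their box sums are nondecreasing
    and bounded. *)
Lemma is_cvg_boxsum (R : realType) (F : Z2 -> R) (B : R) :
  (forall s, uniq s -> \sum_(p <- s) `|F p| <= B) -> cvgn (fun n => boxsum n F).
Proof.
move=> FB.
have cv (G : Z2 -> R) M : (forall p, 0 <= G p) -> (forall n, boxsum n G <= M) ->
    cvgn (fun n => boxsum n G).
  move=> G0 GM; apply: nondecreasing_is_cvgn.
    move=> m n mn; rewrite !boxsumE; apply: ler_sum_uniq_subset; rewrite ?box_uniq//.
    by move=> p; rewrite !mem_box => /andP[h1 h2]; rewrite !(leq_trans _ mn).
  by exists M => _ [n _ <-].
have c1 : cvgn (fun n => boxsum n (fun p => `|F p|)).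
  by apply: (cv _ B) => // n; rewrite boxsumE FB// box_uniq.
have c2 : cvgn (fun n => boxsum n (fun p => `|F p| + F p)).
  apply: (cv _ (B + B)) => [p|n].
    by rewrite -lerBlDr sub0r -normrN ler_norm.
  rewrite boxsumE big_split/= lerD ?FB ?box_uniq//.
  by apply: le_trans (FB (box n) (box_uniq n)); apply: ler_sum => p _; exact: ler_norm.
have -> : (fun n => boxsum n F) =
    ((fun n => boxsum n (fun p => `|F p| + F p)) - (fun n => boxsum n (fun p => `|F p|)))%R.
  apply/funext => n; rewrite !fctE !boxsumE -sumrB; apply: eq_bigr => p _.
  by rewrite addrC addKr.
exact: is_cvgB.
Qed.

Lemma zseries_bound (R : realType) (F : Z2 -> R) (B : R) :
  (forall s, uniq s -> \sum_(p <- s) `|F p| <= B) -> `|zseries F| <= B.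
Proof.
move=> FB; have cF := is_cvg_boxsum R F B FB.
have le n : `|boxsum n F| <= B.
  by rewrite boxsumE (le_trans (ler_norm_sum _ _ _))// FB// box_uniq.
rewrite ler_norml; apply/andP; split.
  apply: limr_ge => //; apply: nearW => n.
  by have := le n; rewrite ler_norml => /andP[].
apply: limr_le => //; apply: nearW => n.
by have := le n; rewrite ler_norml => /andP[].
Qed.

Lemma boxsum_two_points (R : realType) (F : Z2 -> R) (p1 p2 : Z2) :
  p1 != p2 -> (forall p, p != p1 -> p != p2 -> F p = 0) ->
  (boxsum n F @[n --> \oo] --> F p1 + F p2)%classic.
Proof.
move=> p12 F0.
apply: cvg_near_cst.
exists (maxn (maxn `|p1.1| `|p1.2|) (maxn `|p2.1| `|p2.2|)) => // n /=.
rewrite !geq_max => /andP[/andP[h1 h2] /andP[h3 h4]].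
rewrite boxsumE (bigD1_seq p1) ?box_uniq ?mem_box ?h1//.
rewrite -big_filter (bigD1_seq p2) ?filter_uniq ?box_uniq ?mem_filter ?mem_box ?h3 1?eq_sym ?p12//.
rewrite big_filter_cond.
by rewrite big1 /= ?addr0// => p /andP[]; exact: F0.
Qed.

Lemma esum_seq (R : realType) (T : choiceType) (S : set T) (s : seq T) (a : T -> \bar R) :
  uniq s -> (forall i, i \in s -> S i) -> (forall i, 0 <= a i)%E ->
  (forall i, i \notin s -> a i = 0)%E ->
  (\esum_(i in S) a i = \sum_(i <- s) a i)%E.
Proof.
move=> us sS a0 as0; rewrite (esumID [set` s]%classic)// [X in (_ + X)%E]esum1 ?adde0; last first.
  by move=> i [_ /negP]; exact: as0.
rewrite (_ : S `&` [set` s] = [set` s])%classic; last first.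
  by apply/seteqP; split => [i []|i/= si]//; split => //; exact: sS.
by rewrite esum_fset// -fsbig_seq.
Qed.

Lemma sum_seq_le_esum (R : realType) (T : choiceType) (S : set T) (s : seq T) (G : T -> R) :
  uniq s -> (forall i, i \in s -> S i) ->
  ((\sum_(i <- s) G i)%:E <= \esum_(i in S) (G i)%:E)%E.
Proof.
move=> us sS; apply: esum_ge; exists [set` s]%classic; last by rewrite -fsbig_seq// sumEFin.
by split => // i /=; exact: sS.
Qed.

(** Serves both factors of a convolution: [p] to [k - p] is injective, so the shifted sum is again a
    sum over distinct modes. The zero mode, absent from the norm, is harmless as [G] vanishes
    there. *)
Lemma sum_seq_shift_le (R : realType) (G : Z2 -> R) (B : R) (k : Z2) (s : seq Z2) :
  uniq s -> (forall p, 0 <= G p) -> G (0, 0) = 0 ->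
  (\esum_(i in [set k : Z2 | k != (0, 0)%R]) (G i)%:E <= B%:E)%E ->
  \sum_(p <- s) G p <= B /\ \sum_(p <- s) G (Zsub k p) <= B.
Proof.
move=> us G0 G00 GB.
have le t : uniq t -> \sum_(p <- t) G p <= B.
  move=> ut; rewrite (bigID (fun p => p == (0, 0)))/= big1 ?add0r; last by move=> p /eqP->.
  rewrite -big_filter -lee_fin; apply: le_trans GB.
  apply: sum_seq_le_esum; first exact: filter_uniq.
  by move=> i; rewrite mem_filter => /andP[].
split; first exact: le.
rewrite -(big_map (Zsub k) xpredT G) le// map_inj_uniq// => -[a b] [a' b'] /= [].
by move=> /addrI/oppr_inj -> /addrI/oppr_inj ->.
Qed.

(** * Bounds on the multiplier and on the quadratic term *)

Lemma ksq_ge0 (R : realType) (k : Z2) : 0 <= ksq R k.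
Proof. by rewrite addr_ge0 ?sqr_ge0. Qed.

Lemma ksq_ge1 (R : realType) (k : Z2) : k != (0, 0) -> 1 <= ksq R k.
Proof.
case: k => a b; rewrite /ksq/= -!rmorphXn/= -rmorphD/= -[1]/(1%:~R) ler_int xpair_eqE negb_and.
by case/orP; nia.
Qed.

Lemma normr_I1_le1 (R : realType) (k : Z2) : `|I1 R k| <= 1.
Proof.
rewrite /I1; case: ifPn => [_|k0]; first by rewrite normr0.
have k1 := ksq_ge1 R k k0; have kp : 0 < ksq R k by exact: lt_le_trans k1.
rewrite normrM normfV (gtr0_norm kp) ler_pdivrMr// mul1r normrN.
rewrite ler_norml /ksq; apply/andP; split; nra.
Qed.

Lemma normr_I2_le1 (R : realType) (k : Z2) : `|I2 R k| <= 1.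
Proof.
rewrite /I2; case: ifPn => [_|k0]; first by rewrite normr0.
have k1 := ksq_ge1 R k k0; have kp : 0 < ksq R k by exact: lt_le_trans k1.
rewrite normrM normfV (gtr0_norm kp) ler_pdivrMr// mul1r.
by rewrite ger0_norm ?sqr_ge0// /ksq lerDl sqr_ge0.
Qed.

Lemma mult_zero_frequency (R : realType) (alpha : R) (k : Z2) : mult alpha k (0, 0) = 0.
Proof. by rewrite /mult /I1 /I2 eqxx !mulr0 addr0 mulr0. Qed.

Lemma normr_mult_le (R : realType) (alpha : R) (k j : Z2) :
  `|mult alpha k j| <= (`|k.1%:~R| + `|k.2%:~R|) * ksq R j `^ (alpha / 2).
Proof.
rewrite /mult normrM (ger0_norm (powR_ge0 _ _)) mulrC ler_wpM2r ?powR_ge0//.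
rewrite (le_trans (ler_normD _ _))// !normrM lerD// ler_piMr//.
  exact: normr_I1_le1.
exact: normr_I2_le1.
Qed.

(** The multiplier costs [|j|^alpha]; the inequality [2xy <= x^2 + y^2] puts it all on [w j], and
    [alpha <= q] bounds the result by the [H^q] weight, since nonzero modes have modulus at least
    1. *)
Lemma normr_quadratic_term_le (R : realType) (alpha q : R) (w : coef R) (k j : Z2) :
  alpha <= q -> 0 <= q -> w (0, 0) = (0, 0) ->
  `|mult alpha k j * (cmul (w j) (w (Zsub k j))).2| <=
  (`|k.1%:~R| + `|k.2%:~R|) *
  ((ksq R j `^ q * cabs2 (w j) + ksq R (Zsub k j) `^ q * cabs2 (w (Zsub k j))) / 2).
Proof.
move=> aq q0 w0.
have [->|j0] := eqVneq j (0, 0).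
  rewrite mult_zero_frequency mul0r normr0 mulr_ge0// divr_ge0// addr_ge0//.
    by rewrite mulr_ge0 ?powR_ge0// addr_ge0 ?sqr_ge0.
  by rewrite mulr_ge0 ?powR_ge0// addr_ge0 ?sqr_ge0.
rewrite normrM; apply: (le_trans (ler_wpM2r _ (normr_mult_le R alpha k j))) => //.
rewrite -mulrA ler_wpM2l//.
have j1 := ksq_ge1 R j j0.
set u := ksq R j `^ (alpha / 2).
have u0 : 0 <= u by exact: powR_ge0.
have uq : u ^+ 2 <= ksq R j `^ q.
  by rewrite /u -powR_mulrn// -powRrM mulfVK// ler_powR.
have wkj : cabs2 (w (Zsub k j)) <= ksq R (Zsub k j) `^ q * cabs2 (w (Zsub k j)).
  have [->|kj0] := eqVneq (Zsub k j) (0, 0).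
    by rewrite w0 /cabs2/= expr0n addr0 mulr0.
  rewrite ler_peMl ?addr_ge0 ?sqr_ge0//.
  by rewrite -[leLHS](powRr0 (ksq R (Zsub k j))) ler_powR// ksq_ge1.
have wj : u ^+ 2 * cabs2 (w j) <= ksq R j `^ q * cabs2 (w j).
  by rewrite ler_wpM2r// addr_ge0 ?sqr_ge0.
rewrite -[X in X * _](ger0_norm u0) -normrM.
apply: (@le_trans _ _ ((u ^+ 2 * cabs2 (w j) + cabs2 (w (Zsub k j))) / 2)).
  case: (w j) (w (Zsub k j)) => [a b] [c d]; rewrite /cabs2 /cmul/=.
  have h1 := sqr_ge0 (u * a - d); have h2 := sqr_ge0 (u * b - c).
  have h3 := sqr_ge0 (u * a + d); have h4 := sqr_ge0 (u * b + c).
  by rewrite ler_norml; apply/andP; split; lra.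
by rewrite ler_pM2r ?invr_gt0// lerD.
Qed.

Lemma sum_quadratic_term_le (R : realType) (alpha q B : R) (w : coef R) (k : Z2) (s : seq Z2) :
  alpha <= q -> 0 <= q -> w (0, 0) = (0, 0) -> (Hnorm2 q w <= B%:E)%E -> uniq s ->
  \sum_(j <- s) `|mult alpha k j * (cmul (w j) (w (Zsub k j))).2| <=
  (`|k.1%:~R| + `|k.2%:~R|) * B.
Proof.
move=> aq q0 w0 wB us.
have /= := @sum_seq_shift_le R (fun j => ksq R j `^ q * cabs2 (w j)) B k s us.
case=> [p||//|s1 s2]; first by rewrite mulr_ge0 ?powR_ge0// addr_ge0 ?sqr_ge0.
  by rewrite w0 /cabs2/= expr0n addr0 mulr0.
apply: (@le_trans _ _ (\sum_(j <- s) (`|k.1%:~R| + `|k.2%:~R|) *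
  ((ksq R j `^ q * cabs2 (w j) + ksq R (Zsub k j) `^ q * cabs2 (w (Zsub k j))) / 2))).
  by apply: ler_sum => j _; exact: normr_quadratic_term_le.
by rewrite -mulr_sumr ler_wpM2l ?addr_ge0// -mulr_suml big_split/=; lra.
Qed.

(** * Perturbations of the shear flow *)

(* The Fourier coefficients of -2 a sin(x_2) + 2 b cos(N x_1). *)
Definition data (R : realType) (N : nat) (a b : R) : coef R := fun k =>
  if k == (0, 1) then (0, a) else if k == (0, - 1) then (0, - a)
  else if (k == (N%:Z, 0)) || (k == (- N%:Z, 0)) then (b, 0) else (0, 0).

(** The symbol of the second velocity component at frequency [(N, n)]; it is the coefficient [m_n]
    of the linearised system. *)
Definition growth_rate (R : realType) (alpha : R) (N : nat) (n : int) : R :=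
  ksq R (N%:Z, n) `^ (alpha / 2) * (N%:R ^+ 2 / ksq R (N%:Z, n)).

Lemma ksq_neq0 (R : realType) (k : Z2) : k != (0, 0) -> ksq R k != 0.
Proof. by move=> /(ksq_ge1 R) k1; rewrite gt_eqF// (lt_le_trans _ k1). Qed.

(** Both symbols carry the factor [k_1], so a function of [x_2] alone induces no velocity. *)
Lemma mult_shear (R : realType) (alpha : R) (k : Z2) (j2 : int) : mult alpha k (0, j2) = 0.
Proof.
rewrite /mult /I1 /I2/=.
by case: ifP => _; rewrite ?mul0r ?oppr0 ?expr0n ?mul0r !mulr0 addr0 mulr0.
Qed.

(** The velocity is divergence free, so only the difference of the two frequencies acts on it; this
    difference is vertical and meets the second component only. *)
Lemma mult_vertical_shift (R : realType) (alpha : R) (N : nat) (n j : int) : (0 < N)%N ->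
  mult alpha (N%:Z, n) (N%:Z, j) = (n - j)%:~R * growth_rate R alpha N j.
Proof.
move=> N0; have j0 : (N%:Z, j) != (0, 0) by rewrite xpair_eqE; lia.
have h : ksq R (N%:Z, j) != 0 by exact: ksq_neq0.
rewrite /mult /I1 /I2 /growth_rate/= (negbTE j0).
rewrite intrB; field; exact: h.
Qed.

Lemma growth_rate_ge0 (R : realType) (alpha : R) (N : nat) (n : int) : 0 <= growth_rate R alpha N n.
Proof. by rewrite mulr_ge0 ?powR_ge0// divr_ge0 ?exprn_ge0// ksq_ge0. Qed.

(** A bound uniform in [n], from [ksq ^ (alpha / 2) <= ksq]; it supplies the constant [b] of the
    Picard remainder. *)
Lemma growth_rate_le (R : realType) (alpha : R) (N : nat) (n : int) : (0 < N)%N -> alpha <= 2 ->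
  growth_rate R alpha N n <= N%:R ^+ 2.
Proof.
move=> N0 a2.
have k1 : 1 <= ksq R (N%:Z, n) by rewrite ksq_ge1// xpair_eqE; lia.
have kp : 0 < ksq R (N%:Z, n) by exact: lt_le_trans k1.
rewrite /growth_rate mulrCA ler_piMr ?exprn_ge0// ler_pdivrMr// mul1r.
rewrite -[leRHS]powRr1 ?(ltW kp)// ler_powR//; lra.
Qed.

(** For [|n| <= N] the quantity [ksq] lies between [N^2] and [2 N^2]: the first factor is at least
    [N^alpha], the second at least 1/2. *)
Lemma growth_rate_ge (R : realType) (alpha : R) (N : nat) (n : int) : (0 < N)%N -> 0 <= alpha ->
  (`|n| <= N)%N -> N%:R `^ alpha / 2 <= growth_rate R alpha N n.
Proof.
move=> N0 a0 nN.
have N1 : (1 : R) <= N%:R by rewrite ler1n.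
have nN' : (n%:~R : R) ^+ 2 <= N%:R ^+ 2.
  have : n ^+ 2 <= N%:Z ^+ 2 by nia.
  by rewrite -(ler_int R) !rmorphXn.
have k1 : N%:R ^+ 2 <= ksq R (N%:Z, n) by rewrite lerDl sqr_ge0.
have k2 : ksq R (N%:Z, n) <= 2 * N%:R ^+ 2 by rewrite mulr_natl mulr2n lerD2l.
have kp : 0 < ksq R (N%:Z, n) by apply: lt_le_trans k1; rewrite exprn_gt0// ltr0n.
rewrite /growth_rate ler_pM ?powR_ge0//.
  rewrite (_ : N%:R `^ alpha = (N%:R ^+ 2) `^ (alpha / 2)); last first.
    by rewrite -powR_mulrn// -powRrM mulrC mulfVK.
  by rewrite ge0_ler_powR ?nnegrE ?exprn_ge0 ?ksq_ge0// divr_ge0.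
by rewrite ler_pdivlMr// mulrC ler_pdivrMr// mulrC.
Qed.

Lemma Hnorm2_csub_lty (R : realType) (q : R) (f g : coef R) :
  (Hnorm2 q f < +oo)%E -> (Hnorm2 q g < +oo)%E -> (Hnorm2 q (csub f g) < +oo)%E.
Proof.
move=> hf hg.
have p h k : (0 <= (ksq R k `^ q * cabs2 (h k : R * R))%:E)%E.
  by rewrite lee_fin mulr_ge0 ?powR_ge0// addr_ge0 ?sqr_ge0.
have hh : (Hnorm2 q f + Hnorm2 q f + (Hnorm2 q g + Hnorm2 q g) < +oo)%E.
  by rewrite !lte_add_pinfty.
apply: le_lt_trans hh; rewrite /Hnorm2 -!esumD; last first.
all: try by move=> k _; rewrite ?adde_ge0.
apply: le_esum => k _; rewrite -!EFinD lee_fin -!mulrDr ler_wpM2l ?powR_ge0//.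
rewrite /csub /cabs2/=; case: (f k) (g k) => [a b] [c d]/=.
have := sqr_ge0 (a + c); have := sqr_ge0 (b + d); lra.
Qed.

(** Since [fine] sends [+oo] to 0, a bound on [Hnorm] says something about [Hnorm2] only together
    with finiteness. *)
Lemma Hnorm2_le (R : realType) (q B : R) (f : coef R) :
  (Hnorm2 q f < +oo)%E -> Hnorm q f <= B -> (Hnorm2 q f <= (B ^+ 2)%:E)%E.
Proof.
have f0 : (0 <= Hnorm2 q f)%E.
  by apply: esum_ge0 => k _; rewrite lee_fin mulr_ge0 ?powR_ge0// addr_ge0 ?sqr_ge0.
move=> foo; rewrite /Hnorm => h.
have fin : (Hnorm2 q f \is a fin_num)%E by rewrite ge0_fin_numE.
rewrite -(fineK fin) lee_fin -[leLHS]sqr_sqrtr ?fine_ge0//.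
by rewrite ler_sqr ?nnegrE ?sqrtr_ge0// (le_trans _ h)// sqrtr_ge0.
Qed.

Section perturbation.
Context (R : realType) (alpha q : R) (N : nat)
  (aq : alpha <= q) (q0 : 0 <= q) (N0 : (0 < N)%N).

Let shear : coef R := data R N 1 0.

Lemma data_shear_neq0 (k : Z2) (a : R) : k.1 != 0 -> data R N a 0 k = (0, 0).
Proof.
case: k => k1 k2/= k10; rewrite /data !xpair_eqE !(negbTE k10)/=.
by case: ifP.
Qed.

(* The shear has no velocity, so every term with j on the vertical axis
   carries a vanishing multiplier. *)
Lemma quadratic_split (th : coef R) (k j : Z2) :
  mult alpha k j * (cmul (th j) (th (Zsub k j))).2 =
  mult alpha k j * (cmul (th j) (shear (Zsub k j))).2 +
  mult alpha k j * (cmul (csub shear th j) (csub shear th (Zsub k j))).2.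
Proof.
have h : mult alpha k j * (shear j).1 = 0 /\ mult alpha k j * (shear j).2 = 0.
  have [j10|j10] := eqVneq j.1 0; last by rewrite /shear data_shear_neq0// mulr0.
  by case: j j10 => j1 j2 /= ->; rewrite mult_shear !mul0r.
move: h; rewrite /csub /cmul/=.
case: (th j) (th (Zsub k j)) (shear j) (shear (Zsub k j)) => [a b] [c d] [e f] [g i]/=.
move: (mult _ _ _) => m [h1 h2].
rewrite [RHS](_ : _ = m * (a * d + b * c) + m * e * (i - d) + m * f * (g - c)); last by ring.
by rewrite h1 h2 !mul0r !addr0.
Qed.

Lemma linear_term_support (th : coef R) (n : int) (j : Z2) :
  j != (N%:Z, n - 1) -> j != (N%:Z, n + 1) ->
  mult alpha (N%:Z, n) j * (cmul (th j) (shear (Zsub (N%:Z, n) j))).2 = 0.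
Proof.
case: j => j1 j2; rewrite !xpair_eqE => h1 h2.
rewrite /shear /data ifF; last by apply/negP; rewrite /Zsub xpair_eqE/=; lia.
rewrite ifF; last by apply/negP; rewrite /Zsub xpair_eqE/=; lia.
by case: ifP => _; rewrite /cmul/= !mulr0 addr0 mulr0.
Qed.

(** The multiplier contributes [s] and the sine coefficient [i * s]; as [s * s = 1], both neighbours
    enter with a nonnegative coefficient. *)
Lemma linear_term_value (th : coef R) (n s : int) : s = 1 \/ s = - 1 ->
  mult alpha (N%:Z, n) (N%:Z, n - s) * (cmul (th (N%:Z, n - s)) (shear (Zsub (N%:Z, n) (N%:Z, n - s)))).2 =
  growth_rate R alpha N (n - s) * (th (N%:Z, n - s)).1.
Proof.
move=> hs; rewrite mult_vertical_shift// /Zsub/= subrr opprB addrC subrK.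
case: hs => ->; rewrite /shear /data/= /cmul/=; ring.
Qed.

(** By [quadratic_split] the sum is a two-point linear part plus a term quadratic in the deviation
    from the shear. The convergence of the box sums is kept for measurability in time. *)
Lemma rhs_mode (th : coef R) (n : int) (B : R) :
  th (0, 0) = (0, 0) -> (Hnorm2 q (csub shear th) <= B%:E)%E ->
  let F j := mult alpha (N%:Z, n) j * (cmul (th j) (th (Zsub (N%:Z, n) j))).2 in
  (boxsum m F @[m --> \oo] --> (rhs alpha th (N%:Z, n)).1)%classic /\
  `|(rhs alpha th (N%:Z, n)).1 -
    (growth_rate R alpha N (n - 1) * (th (N%:Z, n - 1)).1 +
     growth_rate R alpha N (n + 1) * (th (N%:Z, n + 1)).1)| <= (N%:R + `|n%:~R|) * B.
Proof.
move=> th0 thB F.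
pose F1 j := mult alpha (N%:Z, n) j * (cmul (th j) (shear (Zsub (N%:Z, n) j))).2.
pose F2 j := mult alpha (N%:Z, n) j *
  (cmul (csub shear th j) (csub shear th (Zsub (N%:Z, n) j))).2.
have c1 : (boxsum m F1 @[m --> \oo] --> F1 (N%:Z, n - 1) + F1 (N%:Z, n + 1))%classic.
  apply: boxsum_two_points => [|p]; first by rewrite xpair_eqE; lia.
  exact: linear_term_support.
have w0 : csub shear th (0, 0) = (0, 0).
  rewrite /csub th0 /shear /data/= ifF ?subrr//; apply/negP; rewrite !xpair_eqE; lia.
have s2 s : uniq s -> \sum_(p <- s) `|F2 p| <= (N%:R + `|n%:~R|) * B.
  move=> us; have := sum_quadratic_term_le R alpha q B _ (N%:Z, n) s aq q0 w0 thB us.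
  by rewrite /= normr_nat.
have c2 : (boxsum m F2 @[m --> \oo] --> zseries F2)%classic := is_cvg_boxsum _ _ _ s2.
have cF : (boxsum m F @[m --> \oo] --> F1 (N%:Z, n - 1) + F1 (N%:Z, n + 1) + zseries F2)%classic.
  rewrite (_ : (fun m => boxsum m F) = (fun m => boxsum m F1 + boxsum m F2)).
    exact: cvgD.
  apply/funext => m; rewrite !boxsumE -big_split/=; apply: eq_bigr => p _.
  exact: quadratic_split.
have rE : (rhs alpha th (N%:Z, n)).1 = F1 (N%:Z, n - 1) + F1 (N%:Z, n + 1) + zseries F2.
  exact/cvg_lim.
rewrite rE; split=> //.
have e1 := linear_term_value th n 1 (or_introl erefl).
have := linear_term_value th n (- 1) (or_intror erefl).
rewrite opprK => e2.
by rewrite /F1 e1 e2 addrC addKr zseries_bound.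
Qed.

Lemma perturbed_mode (T a e : R) (th : R -> coef R) :
  (Hnorm2 q shear < +oo)%E -> 0 <= a * e ->
  is_solution alpha q T (data R N 1 e) th ->
  (forall t, 0 <= t <= T -> Hnorm q (csub shear (th t)) <= a * e) ->
  let x n t := (th t (N%:Z, n)).1 in
  let f n t := (rhs alpha (th t) (N%:Z, n)).1 in
  [/\ (forall n t, 0 <= t <= T -> `|x n t| <= a * e),
    (forall n, measurable_fun `[0, T]%classic (f n)),
    (forall n t, 0 <= t <= T ->
     `|f n t - (growth_rate R alpha N (n - 1) * x (n - 1) t +
                growth_rate R alpha N (n + 1) * x (n + 1) t)| <=
       ((N%:R + `|n%:~R|) * a ^+ 2) * e ^+ 2) &
    (forall n t, 0 <= t <= T ->
     x n t = e * (n == 0)%:R + Rintegral (@lebesgue_measure R) `[0, t]%classic (f n))].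
Proof.
move=> shear_oo ae0 [thH _ thm the] thD x f.
have thn t : 0 <= t <= T -> th t (0, 0) = (0, 0) /\
    (Hnorm2 q (csub shear (th t)) <= ((a * e) ^+ 2)%:E)%E.
  move=> tT; have [_ [h0 hoo]] := thH t tT; split=> //.
  by apply: Hnorm2_le (thD t tT); exact: Hnorm2_csub_lty.
have mode n t (tT : 0 <= t <= T) := rhs_mode (th t) n _ (thn t tT).1 (thn t tT).2.
split.
- move=> n t tT; have [h0 h1] := thn t tT.
  (* A single mode is dominated by the whole norm. Only the unshifted sum is kept, so the shift
     [(0, 0)] is arbitrary. *)
  have [||+ _] := @sum_seq_shift_le R (fun j => ksq R j `^ q * cabs2 (csub shear (th t) j))
      _ (0, 0) [:: (N%:Z, n)] isT _ _ h1.
  + by move=> p; rewrite mulr_ge0 ?powR_ge0// addr_ge0 ?sqr_ge0.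
  + rewrite /csub h0 /shear /data/= ifF; last by apply/negP; rewrite !xpair_eqE; lia.
    by rewrite subrr /cabs2/= expr0n addr0 mulr0.
  rewrite big_seq1 /csub /shear data_shear_neq0/=; last by lia.
  rewrite !sub0r /cabs2/= !sqrrN => h2.
  rewrite -ler_sqr ?nnegrE// real_normK ?num_real//.
  apply: le_trans h2; apply: (@le_trans _ _ (x n t ^+ 2 + (th t (N%:Z, n)).2 ^+ 2)).
    by rewrite lerDl sqr_ge0.
  rewrite ler_peMl ?addr_ge0 ?sqr_ge0//.
  rewrite -[leLHS](powRr0 (ksq R (N%:Z, n))) ler_powR// ksq_ge1// xpair_eqE; lia.
- move=> n.
  (* The nonlinear term is a pointwise limit of finite sums of products of measurable
     coefficients. *)
  apply: (@measurable_fun_cvg _ _ _ _ (fun m u => boxsum m (fun j =>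
    mult alpha (N%:Z, n) j * (cmul (th u j) (th u (Zsub (N%:Z, n) j))).2))).
    move=> m; rewrite [X in measurable_fun _ X](_ : _ = (fun u => \sum_(j <- box m)
      mult alpha (N%:Z, n) j * (cmul (th u j) (th u (Zsub (N%:Z, n) j))).2)); last first.
      by apply/funext => u; rewrite boxsumE.
    apply: measurable_sum => j.
    apply: measurable_funM => //.
    have [h1 h2] := thm j; have [h3 h4] := thm (Zsub (N%:Z, n) j).
    by apply: measurable_funD; apply: measurable_funM.
  by move=> u /=; rewrite in_itv/= => /(mode n) [].
- by move=> n t /(mode n)[_]; rewrite exprMn mulrA.
- move=> n t tT; rewrite /x (the t tT (N%:Z, n)).1; congr (_ + _).
  rewrite /data !xpair_eqE ifF; last by apply/negP; lia.
  rewrite ifF; last by apply/negP; lia.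
  by rewrite eqxx; case: (n == 0); rewrite ?andbF/= ?mulr1 ?mulr0.
Qed.
End perturbation.

(** Every term of the convolution vanishes: on the vertical axis the multiplier is 0, off it the
    shear is. *)
Lemma steady_solution (R : realType) (alpha q T : R) (N : nat) :
  (Hnorm2 q (data R N 1 0) < +oo)%E -> realvalued (data R N 1 0) -> meanfree (data R N 1 0) ->
  is_solution alpha q T (data R N 1 0) (fun=> data R N 1 0).
Proof.
move=> h1 h2 h3; split=> //.
- by exists (Hnorm q (data R N 1 0)).
- move=> t tT k.
  (* The boolean treats the real and imaginary parts at once. *)
  have z (i : bool) : zseries (fun j => mult alpha k j * (if i then
     (cmul (data R N 1 0 j) (data R N 1 0 (Zsub k j))).1 else
     (cmul (data R N 1 0 j) (data R N 1 0 (Zsub k j))).2)) = 0.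
    rewrite /zseries (_ : (fun n => _) = cst 0) ?lim_cst//.
    apply/funext => n; rewrite boxsumE big1// => j _.
    have [j10|j10] := eqVneq j.1 0.
      by case: j j10 => j1 j2 /= ->; rewrite mult_shear mul0r.
    rewrite (data_shear_neq0 _ _ _ _ j10) /cmul/= !mul0r subrr addr0.
    by case: i; rewrite mulr0.
  rewrite /rhs /conv/= (z false) (z true) oppr0.
  by rewrite !Rintegral_cst//= !mul0r !addr0.
Qed.

(** * Gevrey norms and conclusion *)

Lemma esum_data (R : realType) (g : Z2 -> R) (N : nat) (a b : R) :
  (0 < N)%N -> (forall k, 0 <= g k) ->
  (\esum_(k in [set k : Z2 | k != (0, 0)%R]) (g k * cabs2 (data R N a b k))%:E)%E =
  (a ^+ 2 * (g (0, 1) + g (0, - 1)) + b ^+ 2 * (g (N%:Z, 0) + g (- N%:Z, 0)))%:E.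
Proof.
move=> N0 g0; rewrite (@esum_seq _ _ _ [:: (0, 1); (0, - 1); (N%:Z, 0); (- N%:Z, 0)]).
- rewrite !big_cons big_nil -!EFinD addr0.
  have -> : data R N a b (0, 1) = (0, a) by [].
  have -> : data R N a b (0, - 1) = (0, - a) by [].
  have -> : data R N a b (N%:Z, 0) = (b, 0).
    by rewrite /data !xpair_eqE !eqxx !andbT; case: eqP => //; lia.
  have -> : data R N a b (- N%:Z, 0) = (b, 0).
    by rewrite /data !xpair_eqE !eqxx !andbT orbT; case: eqP => //; lia.
  by congr (_%:E); rewrite /cabs2/=; ring.
- rewrite /= !inE !xpair_eqE; lia.
- by move=> [i j]; rewrite !inE !xpair_eqE /= xpair_eqE; lia.
- by move=> k; rewrite lee_fin mulr_ge0// addr_ge0 ?sqr_ge0.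
- move=> k; rewrite !inE !negb_or => /and4P[/negbTE h1 /negbTE h2 /negbTE h3 /negbTE h4].
  by rewrite /data h1 h2 h3 h4 /cabs2/= expr0n addr0 mulr0.
Qed.

Lemma realvalued_data (R : realType) (N : nat) (a b : R) : (0 < N)%N -> realvalued (data R N a b).
Proof.
move=> N0 [i j]; rewrite /data /Zopp/= !xpair_eqE.
have -> : (- i == 0) && (- j == 1) = (i == 0) && (j == - 1) by lia.
have -> : (- i == 0) && (- j == - 1) = (i == 0) && (j == 1) by lia.
have -> : (- i == N%:Z) && (- j == 0) = (i == - N%:Z) && (j == 0) by lia.
have -> : (- i == - N%:Z) && (- j == 0) = (i == N%:Z) && (j == 0) by lia.
rewrite (orbC (_ && (j == 0))).
case: ifPn => h1; first by rewrite ifF /= ?opprK//; lia.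
case: ifPn => h2 //=.
by case: ifP => //=; rewrite oppr0.
Qed.

Lemma meanfree_data (R : realType) (N : nat) (a b : R) : (0 < N)%N -> meanfree (data R N a b).
Proof.
move=> N0; rewrite /meanfree /data/= ifF//; apply/negP; rewrite !xpair_eqE; lia.
Qed.

Lemma csub_data (R : realType) (N : nat) (e : R) :
  csub (data R N 1 0) (data R N 1 e) = data R N 0 (- e).
Proof.
apply/funext => k; rewrite /csub /data.
by case: ifP => _ /=; [|case: ifP => _ /=; [|case: ifP => _ /=]];
  rewrite ?subrr ?sub0r ?opprK ?oppr0 ?addrN ?addNr.
Qed.

Definition gevrey_weight (R : realType) (r s tau : R) (k : Z2) : R :=
  ksq R k `^ r * expR (2 * tau * ksq R k `^ (1 / (2 * s))).

Lemma gevrey_weight_ge0 (R : realType) (r s tau : R) (k : Z2) : 0 <= gevrey_weight R r s tau k.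
Proof. by rewrite mulr_ge0 ?powR_ge0 ?expR_ge0. Qed.

Lemma gevrey_weightN (R : realType) (r s tau : R) (k : Z2) :
  gevrey_weight R r s tau (Zopp k) = gevrey_weight R r s tau k.
Proof. by rewrite /gevrey_weight /ksq /Zopp/= !intrN !sqrrN. Qed.

Lemma Gnorm2_data (R : realType) (r s tau : R) (N : nat) (a b : R) : (0 < N)%N ->
  Gnorm2 r s tau (data R N a b) =
  (2 * a ^+ 2 * gevrey_weight R r s tau (0, 1) + 2 * b ^+ 2 * gevrey_weight R r s tau (N%:Z, 0))%:E.
Proof.
move=> N0; rewrite /Gnorm2 (esum_data _ (gevrey_weight R r s tau)) => [|//|k]; last first.
  exact: gevrey_weight_ge0.
rewrite -(gevrey_weightN _ _ _ _ (0, - 1)) -(gevrey_weightN _ _ _ _ (- N%:Z, 0)) /Zopp/= oppr0 !opprK.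
by congr (_%:E); ring.
Qed.

Lemma inG_data (R : realType) (r s tau : R) (N : nat) (a b : R) : (0 < N)%N ->
  inG r s tau (data R N a b).
Proof.
move=> N0; split; first exact: realvalued_data.
by split; [exact: meanfree_data|rewrite Gnorm2_data// ltry].
Qed.

Lemma is_solution_sub (R : realType) (alpha q T T' : R) (th0 : coef R) (th : R -> coef R) :
  T' <= T -> is_solution alpha q T th0 th -> is_solution alpha q T' th0 th.
Proof.
move=> TT [h1 [M h2] h3 h4].
have sub t : 0 <= t <= T' -> 0 <= t <= T by move=> /andP[-> /le_trans->].
split.
- by move=> t /sub/h1.
- by exists M => t /sub/h2.
- move=> k; have [h5 h6] := h3 k.
  have ss : (`[0, T'] `<=` `[0, T])%classic by move=> t /=; rewrite !in_itv/= => /sub.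
  by split; [apply: measurable_funS h5|apply: measurable_funS h6].
- by move=> t /sub/h4.
Qed.

(** With [y = N^beta >= 1], each factor on the right is at most the exponential of a constant times
    [y]. Comparing exponents would bound [N^(alpha - beta)] uniformly in [N]. *)
Lemma expR_powR_not_bounded (R : realType) (alpha beta c r tau K : R) :
  0 < beta -> beta < alpha -> 0 < c -> 0 <= r -> 0 <= tau -> 0 <= K ->
  ~ (forall N, (0 < N)%N ->
       expR (N%:R `^ alpha * c) <= K * (N%:R `^ r * expR (tau * N%:R `^ beta))).
Proof.
move=> b0 ba c0 r0 tau0 K0 H.
set M := K + r / beta + tau.
have M0 : 0 <= M by rewrite !addr_ge0// divr_ge0// ltW.
have ab : 0 < alpha - beta by rewrite subr_gt0.
have bound N : (0 < N)%N -> N%:R `^ (alpha - beta) * c <= M.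
  move=> N0; have Np : 0 < N%:R :> R by rewrite ltr0n.
  set y := N%:R `^ beta.
  have y1 : 1 <= y.
    by rewrite -[leLHS](powRr0 N%:R) ler_powR ?ler1n// ltW.
  have y0 : 0 < y by exact: lt_le_trans y1.
  have hr : N%:R `^ r <= expR (r / beta * y).
    have -> : N%:R `^ r = expR (r / beta * ln y).
      by rewrite ln_powR mulrA mulfVK ?gt_eqF// /powR gt_eqF.
    rewrite ler_expR ler_wpM2l ?divr_ge0 ?(ltW b0)//.
    by rewrite ltW// ln_sublinear.
  have hK : K <= expR (K * y).
    have := expR_ge1Dx (K * y); apply: le_trans.
    by rewrite ler_wpDl// ler_peMr.
  have : expR (N%:R `^ alpha * c) <= expR (M * y).
    rewrite (le_trans (H N N0))// /M !mulrDl !expRD -mulrA.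
    apply: ler_pM => //.
    by rewrite ler_wpM2r ?expR_ge0.
  have -> : N%:R `^ alpha = N%:R `^ (alpha - beta) * y.
    by rewrite -powRD ?subrK//; apply/implyP => _; rewrite gt_eqF.
  by rewrite ler_expR mulrAC ler_pM2r.
(* The first integer beyond the threshold where [N^(alpha - beta)] equals [M / c]. *)
pose N := (Num.trunc ((M / c) `^ (alpha - beta)^-1)).+1.
have := bound N isT; rewrite -ler_pdivlMr//; apply/negP; rewrite -ltNge.
have -> : M / c = ((M / c) `^ (alpha - beta)^-1) `^ (alpha - beta).
  by rewrite -powRrM mulVf ?gt_eqF// powRr1// divr_ge0// ltW.
apply: gt0_ltr_powR; rewrite ?nnegrE ?powR_ge0//.
exact: truncnS_gt.
Qed.

(** The square roots are the Gevrey norms of the shear and of its perturbation. Continuity of [T]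
    and [K] thus gives one time and one Lipschitz constant valid for all small [e]. *)
Lemma continuous_pair_sqrt_near (R : realType) (F : R * R -> R) (u v d : R) :
  {within (@nonneg2 R), continuous F}%classic -> 0 <= u -> 0 <= v -> 0 < d ->
  exists2 e0, 0 < e0 & forall e, 0 < e < e0 ->
    `|F (Num.sqrt u, Num.sqrt u) - F (Num.sqrt u, Num.sqrt (u + e ^+ 2 * v))| < d.
Proof.
move=> /subspace_continuousP cF u0 v0 d0.
have A0 : nonneg2 (Num.sqrt u, Num.sqrt u) by split; exact: sqrtr_ge0.
have /cvgrPdist_lt /(_ d d0) := cF _ A0.
have cp : ((Num.sqrt u, Num.sqrt (u + e ^+ 2 * v)) @[e --> (0 : R)] --> (Num.sqrt u, Num.sqrt u))%classic.
  apply: (@cvg_pair _ _ _ _ (nbhs (Num.sqrt u : R)) (nbhs (Num.sqrt u : R))); first exact: cvg_cst.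
  have c1 : {for 0, continuous (fun e : R => Num.sqrt (u + e ^+ 2 * v))}%classic.
    apply: (@continuous_comp _ _ _ (fun e : R => u + e ^+ 2 * v) Num.sqrt); last exact: sqrt_continuous.
    apply: continuousD; first exact: cvg_cst.
    by apply: continuousM; [exact: exprn_continuous|exact: cvg_cst].
  have : (Num.sqrt (u + e ^+ 2 * v) @[e --> (0 : R)] --> Num.sqrt (u + 0 ^+ 2 * v))%classic := c1.
  by rewrite expr0n mul0r addr0.
move=> /cp[e0/= e00 He]; exists e0 => // e /andP[ep ee].
apply: He; last by split; exact: sqrtr_ge0.
by rewrite /ball_ /= sub0r normrN gtr0_norm.
Qed.

Lemma Gnorm_data (R : realType) (r s tau : R) (N : nat) (a b : R) : (0 < N)%N ->
  Gnorm r s tau (data R N a b) =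
  Num.sqrt (a ^+ 2 * (2 * gevrey_weight R r s tau (0, 1)) +
            b ^+ 2 * (2 * gevrey_weight R r s tau (N%:Z, 0))).
Proof. by move=> N0; rewrite /Gnorm Gnorm2_data//=; congr Num.sqrt; ring. Qed.

Lemma gevrey_weight_horizontal (R : realType) (r s tau : R) (N : nat) :
  gevrey_weight R r s tau (N%:Z, 0) = N%:R `^ (2 * r) * expR (2 * tau * N%:R `^ (1 / s)).
Proof.
rewrite /gevrey_weight /ksq/= expr0n addr0 -powR_mulrn// -!powRrM.
congr (_ * expR (_ * _ `^ _)).
by rewrite invfM !mul1r mulrA mulfV ?mul1r ?pnatr_eq0.
Qed.

Theorem theorem5p4 (R : realType) (alpha q s r : R) :
  1 <= alpha < 2 -> alpha + 1 / 2 < q -> 1 / alpha < s -> 3 < r ->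
  forall tau : R, 0 < tau -> ~ LLWP alpha q r s tau.
Proof.
move=> /andP[a1 a2] aq sa r3 tau tau0 [Tf [Kf [cT cK TK H]]].
have ap : 0 < alpha by lra.
have sp : 0 < s by apply: lt_trans sa; rewrite divr_gt0.
have s_lt : 1 / s < alpha by move: sa; rewrite !ltr_pdivrMr// mulrC.
set gw := gevrey_weight R r s tau.
(* The squared Gevrey norm of the shear, the factor 2 counting the modes [(0, 1)] and [(0, -1)]; [v]
   below is that of [2 cos(N x_1)]. *)
set u := 2 * gw (0, 1).
have u0 : 0 <= u by rewrite mulr_ge0// gevrey_weight_ge0.
set p0 := (Num.sqrt u, Num.sqrt u).
have [T0 K0] : 0 < Tf p0 /\ 0 < Kf p0 by apply: TK; split; exact: sqrtr_ge0.
have T2 : 0 < Tf p0 / 2 by rewrite divr_gt0.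
(* The estimate [exp(N^alpha T / 4) <= 2 a] is used squared, as [v] is a squared norm: hence
   [2 * r], [2 * tau] and the constant 8, being 4 from [(2 a)^2] times 2 from [v]. *)
apply: (@expR_powR_not_bounded R alpha (1 / s) (Tf p0 / 2) (2 * r) (2 * tau)
  (8 * (Kf p0 + 1) ^+ 2)) => //; try lra.
  by rewrite divr_gt0.
  by rewrite mulr_ge0// exprn_ge0//; lra.
move=> N N0; rewrite -gevrey_weight_horizontal -/gw.
set v := 2 * gw (N%:Z, 0).
have v0 : 0 <= v by rewrite mulr_ge0// gevrey_weight_ge0.
(* Lipschitz constant, with a margin of 1 for its variation near [p0], times the Gevrey size of the
   perturbation per unit of [e]. *)
set a := (Kf p0 + 1) * Num.sqrt v.
have a0 : 0 <= a by rewrite mulr_ge0 ?sqrtr_ge0//; lra.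
have [e1 e10 He1] := continuous_pair_sqrt_near R Tf u v _ cT u0 v0 T2.
have [e2 e20 He2] := continuous_pair_sqrt_near R Kf u v 1 cK u0 v0 ltr01.
have e0p : 0 < Num.min e1 e2 by rewrite lt_min e10.
suff : expR (N%:R `^ alpha / 2 * (Tf p0 / 2)) <= 2 * a.
  move=> h; have : expR (N%:R `^ alpha / 2 * (Tf p0 / 2)) ^+ 2 <= (2 * a) ^+ 2.
    by apply: lerXn2r => //; rewrite nnegrE ?expR_ge0// mulr_ge0.
  rewrite expr2 -expRD /a !exprMn sqr_sqrtr// /v => h2.
  rewrite (_ : N%:R `^ alpha * (Tf p0 / 2) =
    N%:R `^ alpha / 2 * (Tf p0 / 2) + N%:R `^ alpha / 2 * (Tf p0 / 2)); last by lra.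
  by apply: (le_trans h2); lra.
apply: (exp_growth_bound R (growth_rate R alpha N)
  (fun n => (N%:R + `|n%:~R|) * a ^+ 2) a (N%:R ^+ 2 + N%:R ^+ 2) _ _ _ e0p) => //.
- by rewrite ltW.
- by move=> n; exact: growth_rate_ge0.
- by move=> n; rewrite lerD// growth_rate_le// ltW.
- by move=> n; rewrite mulr_ge0 ?exprn_ge0// addr_ge0.
- by apply: growth_rate_ge => //; lra.
- by apply: growth_rate_ge => //; lra.
move=> e /andP[ep]; rewrite lt_min => /andP[ee1 ee2].
have := H (data R N 1 0) (data R N 1 e) (inG_data _ _ _ _ _ _ _ N0) (inG_data _ _ _ _ _ _ _ N0).
rewrite csub_data !Gnorm_data// -/gw -/v -/u expr0n expr1n mul1r !mul0r addr0 add0r sqrrN.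
have := He1 e; have := He2 e; rewrite ep ee1 ee2 -/p0.
set p := (_, Num.sqrt (u + e ^+ 2 * v)).
move=> /(_ isT); rewrite ltr_distl => /andP[hK _].
move=> /(_ isT); rewrite ltr_distl => /andP[_ hT].
have Tp : Tf p0 / 2 <= Tf p by lra.
have Kp : Kf p <= Kf p0 + 1 by lra.
move=> /= [th1 [th2 [[_ un1] [sol2 _] close]]].
have Hoo : (Hnorm2 q (data R N 1 0) < +oo)%E.
  rewrite /Hnorm2 (esum_data _ (fun k => ksq R k `^ q)) ?ltry// => k; exact: powR_ge0.
have st := steady_solution R alpha q (Tf p) N Hoo (realvalued_data _ _ _ _ N0) (meanfree_data _ _ _ _ N0).
have sol := is_solution_sub R alpha q _ _ _ _ Tp sol2.
exists (fun n t => (th2 t (N%:Z, n)).1), (fun n t => (rhs alpha (th2 t) (N%:Z, n)).1).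
apply: (@perturbed_mode R alpha q N _ _ N0 (Tf p0 / 2) a e th2) => //; try lra.
- by rewrite mulr_ge0// ltW.
move=> t /andP[t0 tT].
have tp : 0 <= t <= Tf p by rewrite t0 (le_trans tT).
(* Uniqueness identifies [th1] with the steady shear, so [close] bounds the deviation of [th2] from
   it. *)
have := close t tp; rewrite -(un1 _ st t tp) => h; apply: (le_trans h).
rewrite sqrtrM ?exprn_ge0 ?(ltW ep)// sqrtr_sqr gtr0_norm// /a -mulrA [e * _]mulrC.
by rewrite ler_wpM2r// mulr_ge0 ?sqrtr_ge0// ltW.
Qed.
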